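(* Let $\mathbb{K}$ be a field, let $G$ be a graph with vertex set $\{v_1,\dots,v_n\}$, let $S=\mathbb{K}[x_1,\dots,x_n]$, and let $I=I(G)\subseteq S$ be the edge ideal of $G$. Let $p$ be the number of bipartite connected components of $G$. Then for every integer $k\geq 0$, we have ${\rm sdepth}(\overline{I^k}/\overline{I^{k+1}})\geq p$.
   Context: Graphs are finite and simple. The edge ideal of $G$ is $I(G)=(x_ix_j : \{v_i,v_j\}\in E(G))\subseteq S$, and $I^0=S$. For an ideal $J\subseteq S$, $\overline{J}$ denotes its integral closure; if $J$ is a monomial ideal, $\overline{J}$ is the monomial ideal generated by all monomials $u\in S$ such that $u^r\in J^r$ for some integer $r\geq 1$. An isolated vertex counts as a bipartite connected component. Stanley depth: let $M$ be a finitely generated $\mathbb{Z}^n$-graded $S$-module. For a homogeneous $u\in M$ and $Z\subseteq\{x_1,\dots,x_n\}$, the $\mathbb{K}$-subspace $u\mathbb{K}[Z]$ of $M$ generated by all $uv$ with $v$ a monomial in $\mathbb{K}[Z]$ is called a Stanley space of dimension $|Z|$ if it is a free $\mathbb{K}[Z]$-module. A Stanley decomposition $\mathcal{D}$ of $M$ is a decomposition of $M$ (as a $\mathbb{K}$-vector space) as a finite direct sum of Stanley spaces; ${\rm sdepth}(\mathcal{D})$ is the minimum dimension of a Stanley space in $\mathcal{D}$, and ${\rm sdepth}(M)$ is the maximum of ${\rm sdepth}(\mathcal{D})$ over all Stanley decompositions $\mathcal{D}$ of $M$. By convention ${\rm sdepth}(0)=\infty$. *)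

(* Defs.v *)
From Stdlib Require Import ClassicalEpsilon.
From mathcomp Require Import all_boot all_order all_algebra.
From mathcomp Require Import mpoly.

Set Implicit Arguments.
Unset Strict Implicit.
Unset Printing Implicit Defensive.

Import GRing.Theory.
Local Open Scope ring_scope.

(* Ideals of a commutative ring are handled as Prop-valued predicates. *)

Section Ideals.
Variable R : comNzRingType.
Implicit Types (G I J : R -> Prop) (f : R).

Definition ideal_gen G f : Prop :=
  exists2 s : seq (R * R),
    forall q, q \in s -> G q.2 & f = \sum_(q <- s) q.1 * q.2.

Definition ideal_mul I J : R -> Prop :=
  ideal_gen (fun h => exists a b, [/\ I a, J b & h = a * b]).

(* The zeroth power is the whole ring, also for the zero ideal. *)
Fixpoint ideal_exp I (k : nat) : R -> Prop :=
  if k is k'.+1 then ideal_mul I (ideal_exp I k') else fun=> True.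

(* f satisfies an equation of integral dependence
   f^r + a_1 f^(r-1) + ... + a_r = 0 with r >= 1 and a_i in J^i. *)
Definition integral_closure J f : Prop :=
  exists (r : nat) (a : nat -> R),
    [/\ (0 < r)%N,
        forall i, (1 <= i <= r)%N -> ideal_exp J i (a i)
      & f ^+ r + \sum_(1 <= i < r.+1) a i * f ^+ (r - i) = 0].

End Ideals.

Section Graphs.
Variables (n : nat) (e : rel 'I_n).

(* mpoly shadows symmetric. *)
Definition simple_graph : Prop := ssrbool.symmetric e /\ irreflexive e.

Definition components : {set {set 'I_n}} :=
  equivalence_partition (connect e) [set: 'I_n].

(* A is one side of a bipartition of the subgraph induced on C. *)
Definition bipartite (C : {set 'I_n}) : bool :=
  [exists A : {set 'I_n}, [forall x in C, [forall y in C,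
     e x y ==> ((x \in A) != (y \in A))]]].

Definition num_bipartite_components : nat :=
  #|[set C in components | bipartite C]|.

Definition edge_ideal (K : fieldType) : {mpoly K[n]} -> Prop :=
  ideal_gen (fun f => exists i j, e i j /\ f = 'X_i * 'X_j).

End Graphs.
Arguments edge_ideal {n} e K _.

(* Stanley decompositions of the Z^n-graded module J / J', for monomial ideals
   J' <= J of S = K[x_1, ..., x_n].  An element of J / J' is represented by an
   element of J, two elements being identified when they differ by an element
   of J'. *)

Section StanleyDepth.
Variables (K : fieldType) (n : nat).
Implicit Types (J : {mpoly K[n]} -> Prop) (u f g : {mpoly K[n]}).
Implicit Types (Z : {set 'I_n}).

(* The subring K[Z]. *)
Definition in_KZ Z g : bool :=
  all (fun m : 'X_{1..n} => [forall i, (m i != 0)%N ==> (i \in Z)]) (msupp g).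

(* The Z^n-homogeneous elements of S are the scalar multiples of monomials. *)
Definition multihomog u : Prop := exists c m, u = c *: 'X_[m].

(* The class of u is homogeneous and uK[Z] is a free K[Z]-module in J / J'
   (g = 1 gives u != 0 in J / J'). *)
Definition stanley_space J J' u Z : Prop :=
  [/\ J u, multihomog u & forall g, in_KZ Z g -> J' (u * g) -> g = 0].

(* A finite family of pairs (u, Z), standing for the subspaces uK[Z]. *)
Record stanley_family := StanleyFamily {
  sf_size : nat;
  sf_gen : 'I_sf_size -> {mpoly K[n]};
  sf_vars : 'I_sf_size -> {set 'I_n} }.
Arguments sf_gen : clear implicits.
Arguments sf_vars : clear implicits.
Implicit Types D : stanley_family.

(* The last two clauses say that J / J' is the sum of the spaces, and that
   this sum is direct. *)
Definition stanley_decomposition J J' D : Prop :=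
  [/\ forall i, stanley_space J J' (sf_gen D i) (sf_vars D i),
      forall f, J f -> exists2 g : 'I_(sf_size D) -> {mpoly K[n]},
        forall i, in_KZ (sf_vars D i) (g i)
        & J' (f - \sum_i sf_gen D i * g i)
    & forall g : 'I_(sf_size D) -> {mpoly K[n]},
        (forall i, in_KZ (sf_vars D i) (g i)) ->
        J' (\sum_i sf_gen D i * g i) ->
        forall i, J' (sf_gen D i * g i)].

(* Depths live in nat with a top element, None standing for infinity. *)
Definition sdepth_decomposition D : option nat :=
  if sf_size D == 0%N then None
  else Some (\big[minn/n]_(i < sf_size D) #|sf_vars D i|).

Definition decideb (P : Prop) : bool :=
  if excluded_middle_informative P then true else false.

(* The maximum of the depths of the Stanley decompositions.  When J / J' is
   nonzero its decompositions are nonempty, so their depths are at most n. *)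
Definition sdepth J J' : option nat :=
  if decideb (forall f, J f -> J' f) then None
  else Some (\max_(d < n.+1 | decideb (exists D,
         stanley_decomposition J J' D /\
         sdepth_decomposition D = Some (nat_of_ord d))) d)%N.

End StanleyDepth.

Definition leq_infty (a b : option nat) : bool :=
  match a, b with
  | _, None => true
  | None, Some _ => false
  | Some a, Some b => (a <= b)%N
  end.

(* Main.v *)
From Stdlib Require Import ClassicalEpsilon.
From HB Require Import structures.
Require Import Defs.
From mathcomp Require Import all_boot all_order all_algebra.
From mathcomp Require Import perm mpoly zify ring.

Set Implicit Arguments.
Unset Strict Implicit.
Unset Printing Implicit Defensive.

Import GRing.Theory.
Local Open Scope nat_scope.

(** Give the vertices weights w(i) in {0, 1, 2} with w(i) + w(j) >= 2 on every
    edge, and let nu2(m) be the least value of w.m over these covers.  By linear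
    programming duality nu2(m) is twice the fractional matching number of the
    vertex capacities m, so a monomial x^m should lie in the integral closure of
    I^k exactly when nu2(m) >= 2k; and the integral closure is spanned by its
    monomials (integral_closure_edge_ideal).  If f is integral over I^k, grade S by
    a cover w: the elements of I^k have order at least 2k, hence so has f.
    Conversely let N be the ideal generated by the finitely many monomials x^h in
    a box with nu2(h) >= n^2.  If nu2(m) >= 2k then x^m N is contained in I^k N,
    because a monomial of large nu2 is divisible by an edge monomial whose
    removal lowers nu2 by at most 2 (nu2_ge_edge, from the min-max theorem
    konig).  The determinant trick then shows that f is integral.

    So the task is to cut the layer 2k <= nu2(m) < 2k+2 of exponent vectors into
    finitely many orthants s + N^Z with |Z| >= p.  On a connected component, say
    that j is flat at m if some cover that is optimal for m on that component
    vanishes at j: raising m(j) then leaves nu2 unchanged.  Raising m(j) keeps j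
    flat and makes no new vertex of the component flat, so the least flat vertex of
    each component does not change when one moves along it.  Call the set of
    these least flat vertices directions(m).  The vectors therefore fall into
    orthants along their directions, one for each vector that cannot be lowered
    along a direction without losing it (a corner).  Truncating all exponents at
    2k+2 does not change the layer, which leaves finitely many corners.  Finally a
    bipartite component always has a flat vertex: a cover that is positive on it
    costs at least its total capacity, while the cover equal to 2 on the lighter
    side and 0 on the other costs no more. *)

(** * A min-max theorem for bipartite matchings with capacities *)

Lemma sum_setUI (T : finType) (r : T -> nat) (A B : {set T}) :
  \sum_(i in A :|: B) r i + \sum_(i in A :&: B) r i
    = \sum_(i in A) r i + \sum_(i in B) r i.
Proof.
rewrite !(big_mkcond (fun i => i \in _)) -!big_split /=.
by apply: eq_bigr => i _; rewrite !inE; case: (i \in A); case: (i \in B) => /=; lia.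
Qed.

Lemma sum_pred1D (T : finType) (r : T -> nat) (x : T) (A : {set T}) :
  \sum_(i in A) (r i + (i == x)) = \sum_(i in A) r i + (x \in A).
Proof.
rewrite big_split /=; congr (_ + _).
case: (boolP (x \in A)) => xA.
  rewrite (bigD1 x) //= eqxx big1 // => i /andP[_ /negPf->] //.
by rewrite big1 // => i iA; case: eqP => // ix; rewrite -ix iA in xA.
Qed.

Definition covers (T : finType) (E : {set T * T}) (A B : {set T}) : bool :=
  [forall x in E, (x.1 \in A) || (x.2 \in B)].

(** Induction on k and the number of edges.  Pick an edge x between two vertices
    of positive capacity.  Either x can be deleted without creating a cover
    cheaper than k, or x can be matched once: if both moves failed, there would
    be a cheap cover avoiding both ends of x and a tight cover containing both,
    and uncrossing them would give a cover cheaper than k. *)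
Lemma konig (T : finType) (E : {set T * T}) (r c : T -> nat) (k : nat) :
  (forall A B, covers E A B -> k <= \sum_(i in A) r i + \sum_(j in B) c j) ->
  exists y : T -> T -> nat,
    [/\ forall i j, 0 < y i j -> (i, j) \in E,
        forall i, \sum_j y i j <= r i,
        forall j, \sum_i y i j <= c j
      & \sum_i \sum_j y i j = k].
Proof.
elim: {E}_.+1 {-2}E (ltnSn #|E|) k r c => // N IHN E leEN.
elim=> [|k IHk] r c minE.
  by exists (fun _ _ => 0); split=> // [i|j|]; rewrite ?big1 // => i _; rewrite big1.
have [x xE /andP[r_gt0 c_gt0]] : exists2 x, x \in E & (0 < r x.1) && (0 < c x.2).
  apply/exists_inP; apply: contraT; rewrite negb_exists_in => /forall_inP noE.
  have: covers E [set i | r i == 0] [set j | c j == 0].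
    by apply/forall_inP => x /noE; rewrite !inE; lia.
  by move/minE; rewrite !big1 // => i; rewrite inE => /eqP.
case: (boolP [forall A, forall B, covers (E :\ x) A B ==>
                (k < \sum_(i in A) r i + \sum_(j in B) c j)]) => [redE|].
  have [||y [yE yr yc yk]] := IHN (E :\ x) _ k.+1 r c.
  - by move: leEN; rewrite (cardsD1 x E) xE.
  - by move=> A B; move/forallP/(_ A)/forallP/(_ B)/implyP: redE.
  by exists y; split=> // i j /yE; rewrite in_setD1 => /andP[].
move=> /forallPn[A /forallPn[B]]; rewrite negb_imply -leqNgt => /andP[covAB leAB].
have coverE A' B' : covers (E :\ x) A' B' -> (x.1 \in A') || (x.2 \in B') ->
    covers E A' B'.
  move=> /forall_inP cov covx; apply/forall_inP => z zE.
  by have [->//|zx] := eqVneq z x; apply: cov; rewrite in_setD1 zx.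
have nx : ~~ ((x.1 \in A) || (x.2 \in B)).
  by apply/negP => /(coverE _ _ covAB)/minE; lia.
pose r' i := r i - (i == x.1); pose c' j := c j - (j == x.2).
have r'E i : r i = r' i + (i == x.1) by rewrite /r'; case: eqP => [->|]; lia.
have c'E j : c j = c' j + (j == x.2) by rewrite /c'; case: eqP => [->|]; lia.
have sumr (S : {set T}) : \sum_(i in S) r i = \sum_(i in S) r' i + (x.1 \in S).
  by rewrite -(sum_pred1D r'); apply: eq_bigr.
have sumc (S : {set T}) : \sum_(i in S) c i = \sum_(i in S) c' i + (x.2 \in S).
  by rewrite -(sum_pred1D c'); apply: eq_bigr.
have [|y [yE yr yc yk]] := IHk r' c'.
  move=> A' B' cov'; have := minE _ _ cov'; rewrite sumr sumc.
  case A'x: (x.1 \in A'); case B'x: (x.2 \in B'); try by lia.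
  move=> _.
  (* (A', B') contains both ends of x, so each of the two combinations below still
     covers x.  Their total cost is that of (A, B) plus that of (A', B'), and (A, B)
     costs at most k. *)
  have [cov1 cov2] : covers E (A :|: A') (B :&: B') /\ covers E (A :&: A') (B :|: B').
    move/forall_inP in cov'; move/forall_inP in covAB.
    split; apply: coverE; rewrite ?inE ?A'x ?B'x ?orbT //.
      apply/forall_inP => z zE; move: (zE) => /covAB; rewrite !inE.
      move: zE; rewrite in_setD1 => /andP[_ /cov'].
      by case: (z.1 \in A); case: (z.1 \in A'); case: (z.2 \in B); case: (z.2 \in B').
    apply/forall_inP => z zE; move: (zE) => /covAB; rewrite !inE.
    move: zE; rewrite in_setD1 => /andP[_ /cov'].
    by case: (z.1 \in A); case: (z.1 \in A'); case: (z.2 \in B); case: (z.2 \in B').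
  have := minE _ _ cov1; have := minE _ _ cov2.
  have := sum_setUI r A A'; have := sum_setUI c B B'.
  by have := sumr A'; have := sumc B'; rewrite A'x B'x; lia.
exists (fun i j => y i j + ((i == x.1) && (j == x.2))).
have delta (p : pred T) (b : bool) z : p =1 pred1 z -> \sum_j (p j && b : nat) = b.
  move=> pz; rewrite (bigD1 z) //= (pz z) /= eqxx big1 ?addn0 // => j /negPf jz.
  by rewrite (pz j) /= jz.
split.
- move=> i j; case: eqP => [->|_] /=; last by rewrite addn0 => /yE.
  case: eqP => [->|_]; last by rewrite addn0 => /yE.
  by rewrite -surjective_pairing.
- move=> i; rewrite big_split /= (eq_bigr _ (fun j _ => congr1 nat_of_bool (andbC _ _))).
  by rewrite (delta _ _ x.2) // (r'E i) leq_add2r.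
- by move=> j; rewrite big_split /= (delta _ _ x.1) // (c'E j) leq_add2r.
- under eq_bigr => i _.
    rewrite big_split /= (eq_bigr _ (fun j _ => congr1 nat_of_bool (andbC _ _))).
    rewrite (delta _ _ x.2) //; over.
  rewrite big_split /= yk.
  under [X in _ + X]eq_bigr => i _ do rewrite -[_ == _]andbT.
  by rewrite (delta _ _ x.1) // addn1.
Qed.

(** * Covers and the fractional matching number *)

Section TwoCovers.
Variables (n : nat) (e : rel 'I_n).
Hypothesis e_graph : simple_graph e.
Implicit Types (w : {ffun 'I_n -> 'I_3}) (m : 'X_{1..n}) (A : pred 'I_n).

(** Twice a fractional vertex cover; the values 0, 1, 2 suffice because the
    extreme fractional covers of a graph are half-integral. *)
Definition two_cover w : bool := [forall i, forall j, e i j ==> (2 <= w i + w j)].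

Lemma two_coverP w : reflect (forall i j, e i j -> 2 <= w i + w j) (two_cover w).
Proof.
apply: (iffP forallP) => [cw i j eij|cw i].
  by move/forallP/(_ j)/implyP: (cw i); apply.
by apply/forallP => j; apply/implyP; apply: cw.
Qed.

Definition weight A w m : nat := \sum_(i | A i) w i * m i.

Lemma weightD A w m1 m2 : weight A w (m1 + m2) = weight A w m1 + weight A w m2.
Proof. by rewrite -big_split; apply: eq_bigr => i _; rewrite mnmDE mulnDr. Qed.

Lemma weightU A w i : weight A w U_(i) = if A i then val (w i) else 0.
Proof.
rewrite /weight big_mkcond (bigD1 i) //= big1 => [|j /negPf ji].
  by rewrite mnm1E eqxx muln1 addn0.
by rewrite mnm1E eq_sym ji muln0 if_same.
Qed.

Lemma weightMn A w m r : weight A w (m *+ r) = weight A w m * r.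
Proof. by rewrite big_distrl; apply: eq_bigr => i _; rewrite mulmnE mulnA. Qed.

Lemma weight_le A w m1 m2 : (forall i, A i -> m1 i <= m2 i) ->
  weight A w m1 <= weight A w m2.
Proof. by move=> le12; apply: leq_sum => i Ai; rewrite leq_mul2l le12 ?orbT. Qed.

Definition trunc N m : 'X_{1..n} := [multinom minn (m i) N | i < n].

Lemma truncE N m i : trunc N m i = minn (m i) N.
Proof. exact: mnmE. Qed.

(** Twice the fractional matching number of G with vertex capacities m is at least
    t, in the dual form: the minimum over covers makes the bound superadditive
    and homogeneous in m at once. *)
Definition nu2_ge (t : nat) m : bool :=
  [forall w, two_cover w ==> (t <= weight predT w m)].

Lemma nu2_geP t m :
  reflect (forall w, two_cover w -> t <= weight predT w m) (nu2_ge t m).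
Proof.
by apply: (iffP forallP) => H w; [move=> cw; exact: (implyP (H w)) | apply/implyP/H].
Qed.

Lemma nu2_geW s t m : t <= s -> nu2_ge s m -> nu2_ge t m.
Proof. by move=> ts /nu2_geP ms; apply/nu2_geP => w /ms; apply: leq_trans. Qed.

Lemma nu2_geD s t m1 m2 : nu2_ge s m1 -> nu2_ge t m2 -> nu2_ge (s + t) (m1 + m2)%MM.
Proof.
move=> /nu2_geP m1s /nu2_geP m2t; apply/nu2_geP => w cw.
by rewrite weightD leq_add ?m1s ?m2t.
Qed.

Lemma nu2_geMn s m r : nu2_ge s m -> nu2_ge (s * r) (m *+ r)%MM.
Proof.
by move=> /nu2_geP ms; apply/nu2_geP => w cw; rewrite weightMn leq_mul2r ms ?orbT.
Qed.

Lemma nu2_ge_le t m1 m2 : (forall i, m1 i <= m2 i) -> nu2_ge t m1 -> nu2_ge t m2.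
Proof.
move=> le12 /nu2_geP m1t; apply/nu2_geP => w /m1t /leq_trans; apply.
exact: weight_le.
Qed.

(** A cover positive at some vertex of capacity N already costs N; any other cover
    does not see the truncation. *)
Lemma nu2_ge_trunc t N m : t <= N -> nu2_ge t (trunc N m) = nu2_ge t m.
Proof.
move=> leN; apply/idP/idP => [|/nu2_geP mt].
  by apply: nu2_ge_le => i; rewrite truncE geq_minl.
apply/nu2_geP => w cw.
have [i /andP[wi mi]|smallm] := pickP (fun i => (0 < w i) && (N <= m i)).
  rewrite /weight (bigD1 i) //= truncE (minn_idPr mi).
  by case: (nat_of_ord (w i)) wi => // a _; lia.
rewrite (leq_trans (mt w cw)) // /weight leq_sum // => i _.
by have := smallm i; rewrite truncE; case: (nat_of_ord (w i)) => // a; lia.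
Qed.

(** Take an integral matching y of size t + 2 on the bipartite double cover of G.  As
    2(t + 2) exceeds the number n^2 of vertex pairs, some edge ij is used twice,
    counting both of its lifts.  Twice the cost of a cover w is at least the sum of
    y(a, b) (w(a) + w(b)), where every term has factor at least 2 and the two uses
    of ij have factor w(i) + w(j); so w still costs at least t after the removal. *)
Lemma nu2_ge_edge t m : nu2_ge t.+2 m -> n ^ 2 <= t ->
  exists i j, [/\ e i j, (U_(i) + U_(j) <= m)%MM & nu2_ge t (m - (U_(i) + U_(j)))%MM].
Proof.
move=> /nu2_geP mt le_t.
have [A B covAB|y [yE yr yc yt]] :=
    @konig _ [set x : 'I_n * 'I_n | e x.1 x.2] m m t.+2.
  (* A cover of the double cover folds to a cover of G of the same cost. *)
  pose w : {ffun 'I_n -> 'I_3} := [ffun i => inord ((i \in A) + (i \in B))].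
  have wE i : w i = (i \in A) + (i \in B) :> nat.
    by rewrite ffunE inordK //; case: (i \in A); case: (i \in B).
  have cw : two_cover w.
    apply/two_coverP => i j eij; rewrite !wE.
    have eji : e j i by rewrite e_graph.1.
    have := forall_inP covAB (i, j); rewrite inE => /(_ eij).
    have := forall_inP covAB (j, i); rewrite inE => /(_ eji) /=.
    by case: (i \in A); case: (i \in B); case: (j \in A); case: (j \in B).
  rewrite (leq_trans (mt w cw)) // /weight !(big_mkcond (fun i => i \in _)) /=.
  by rewrite -big_split leq_sum // => i _; rewrite wE;
    case: (i \in A); case: (i \in B) => /=; lia.
have [i [j yij]] : exists i j, 1 < y i j + y j i.
  case: (boolP [exists i, exists j, 1 < y i j + y j i]).
    by case/existsP => i /existsP[j yij]; exists i, j.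
  move=> /existsPn no; suff: t.+2 + t.+2 <= n ^ 2 by lia.
  rewrite -{1}yt -yt [X in _ + X]exchange_big -big_split /=.
  have -> : n ^ 2 = \sum_(i < n) \sum_(j < n) 1.
    by rewrite sum_nat_const sum1_card card_ord.
  apply: leq_sum => i _; rewrite -big_split leq_sum // => j _ /=.
  by have /existsPn/(_ j) := no i; rewrite -leqNgt.
have yle a b : y a b <= m a /\ y a b <= m b.
  split; first by apply: leq_trans (yr a); rewrite (bigD1 b) //= leq_addr.
  by apply: leq_trans (yc b); rewrite (bigD1 a) //= leq_addr.
have eij : e i j.
  have [y0|/yE] := posnP (y i j); last by rewrite inE.
  by have := yE j i; rewrite inE y0 in yij * => /(_ (ltnW yij)); rewrite e_graph.1.
have nij : i != j by apply: contraTneq eij => ->; rewrite e_graph.2.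
have leij : (U_(i) + U_(j) <= m)%MM.
  apply/mnm_lepP => a; rewrite mnmDE !mnm1E.
  case: (eqVneq i a) => [<-|_]; rewrite ?(eq_sym j) ?(negPf nij).
    by have := yle i j; have := yle j i; lia.
  case: (eqVneq j a) => [<-|_] //.
  by have := yle i j; have := yle j i; lia.
exists i, j; split=> //; apply/nu2_geP => w cw.
set m' := (m - _)%MM.
have wm : weight predT w m = weight predT w m' + (w i + w j).
  by rewrite -{1}(submK leij) weightD weightD !weightU.
suff: 2 * t.+2 + 2 * (w i + w j - 2) <= 2 * weight predT w m.
  by have := two_coverP _ cw _ _ eij; lia.
have le1 : \sum_a \sum_b w a * y a b <= weight predT w m.
  by apply: leq_sum => a _; rewrite -big_distrr leq_mul2l yr orbT.
have le2 : \sum_a \sum_b w b * y a b <= weight predT w m.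
  rewrite exchange_big; apply: leq_sum => a _ /=.
  by rewrite -big_distrr leq_mul2l yc orbT.
have eqy a b : w a * y a b + w b * y a b = 2 * y a b + (w a + w b - 2) * y a b.
  have [->|/yE] := posnP (y a b); first by rewrite !muln0.
  by rewrite inE -!mulnDl => /(two_coverP _ cw)/subnKC->.
have : \sum_a \sum_b (2 * y a b + (w a + w b - 2) * y a b) <= 2 * weight predT w m.
  apply: leq_trans (_ : _ <= weight predT w m + weight predT w m) _; last by lia.
  apply: leq_trans (leq_add le1 le2); rewrite -big_split leq_sum // => a _ /=.
  by rewrite -big_split leq_sum // => b _ /=; rewrite eqy.
apply: leq_trans.
under eq_bigr => a _ do rewrite big_split -big_distrr /=.
rewrite big_split -big_distrr /= yt leq_add2l.
have row (F : 'I_n -> nat) b : F b <= \sum_c F c by rewrite (bigD1 b) //= leq_addr.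
rewrite (bigD1 i) //= [X in _ <= _ + X](bigD1 j) 1?eq_sym //=.
have le_i := row (fun b => (w i + w b - 2) * y i b) j.
have le_j := row (fun b => (w j + w b - 2) * y j b) i.
apply: leq_trans (leq_add le_i (leq_trans le_j (leq_addr _ _))).
by rewrite (addnC (w j)) -mulnDr mulnC leq_mul2l yij orbT.
Qed.

End TwoCovers.

(** * Directions in which the matching number is constant *)

Lemma mnm_supported_ind (n : nat) (A : {set 'I_n}) (P : 'X_{1..n} -> Prop) :
  P 0%MM -> (forall (z : 'X_{1..n}) i, i \in A -> P z -> P (z + U_(i))%MM) ->
  forall z : 'X_{1..n}, (forall i, 0 < z i -> i \in A) -> P z.
Proof.
move=> P0 PU z; elim: {z}(mdeg z) {-2}z (erefl (mdeg z)) => [|d IHd] z.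
  by move/eqP; rewrite mdeg_eq0 => /eqP->.
move=> deg_z zA.
have [i zi] : exists i, 0 < z i.
  apply/existsP; apply: contraT; rewrite negb_exists => /forallP z0.
  by move: deg_z; rewrite mdegE big1 // => i _; move: (z0 i); case: (z i).
have def_z : z = (z - U_(i) + U_(i))%MM by rewrite submK // lep1mP -lt0n.
rewrite def_z; apply: PU; first exact: zA.
apply: IHd => [|l]; first by move: deg_z; rewrite {1}def_z mdegD mdeg1 addn1 => -[].
by rewrite mnmBE => zl; apply: zA; apply: leq_trans zl (leq_subr _ _).
Qed.

Section FreeDirections.
Variables (n : nat) (e : rel 'I_n).
Hypothesis e_graph : simple_graph e.
Implicit Types (w : {ffun 'I_n -> 'I_3}) (m : 'X_{1..n}) (i j l : 'I_n).

Definition optimal j w m : bool :=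
  two_cover e w &&
  [forall w', two_cover e w' ==> (weight (connect e j) w m <= weight (connect e j) w' m)].

Lemma optimalP j w m :
  reflect (two_cover e w /\ forall w', two_cover e w' ->
             weight (connect e j) w m <= weight (connect e j) w' m)
          (optimal j w m).
Proof.
apply: (iffP andP) => -[cw H]; split=> //; first by move=> w'; apply/implyP/(forallP H).
by apply/forallP => w'; apply/implyP/H.
Qed.

(** The cover w is asked to be optimal on the component of j only, so that flatness
    at j depends on m through that component alone. *)
Definition flat m : {set 'I_n} := [set j | [exists w, optimal j w m && (w j == ord0)]].

Lemma flatP m j : reflect (exists2 w, optimal j w m & w j = ord0) (j \in flat m).
Proof.
rewrite inE; apply: (iffP existsP) => [[w /andP[ow /eqP wj]]|[w ow wj]]; exists w => //.
by rewrite ow wj eqxx.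
Qed.

(** The least flat vertex of each component, when there is one.  Choosing the least
    vertex makes the choice stable under raising m along it. *)
Definition directions m : {set 'I_n} :=
  [set j in flat m | [forall i in flat m, connect e j i ==> (j <= i)]].

Lemma directionsP m j :
  reflect (j \in flat m /\ forall i, i \in flat m -> connect e j i -> j <= i)
          (j \in directions m).
Proof.
rewrite [j \in directions m]in_set; apply: (iffP andP) => -[jf H]; split=> //.
  by move=> i im; apply/implyP; apply: (forall_inP H).
by apply/forall_inP => i im; apply/implyP; apply: H.
Qed.

Lemma connect_same i j : connect e i j -> connect e i =1 connect e j.
Proof. exact: (same_connect (sym_connect_sym e_graph.1)). Qed.

Lemma weight_same i j w m : connect e i j ->
  weight (connect e i) w m = weight (connect e j) w m.
Proof. by move=> cij; apply: eq_bigl; apply: connect_same. Qed.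

Lemma weight_local j w m1 m2 : (forall i, connect e j i -> m1 i = m2 i) ->
  weight (connect e j) w m1 = weight (connect e j) w m2.
Proof. by move=> m12; apply: eq_bigr => i /m12->. Qed.

Lemma flat_local j m1 m2 : (forall i, connect e j i -> m1 i = m2 i) ->
  (j \in flat m1) = (j \in flat m2).
Proof.
move=> m12; rewrite !inE; apply: eq_existsb => w; congr (_ && _); congr (_ && _).
by apply: eq_forallb => w'; rewrite !(weight_local _ m12).
Qed.

Lemma directions_local j m1 m2 : (forall i, connect e j i -> m1 i = m2 i) ->
  (j \in directions m1) = (j \in directions m2).
Proof.
move=> m12.
have flat12 i : connect e j i -> (i \in flat m1) = (i \in flat m2).
  by move=> cji; apply: flat_local => l cil; apply: m12; apply: connect_trans cil.
rewrite [j \in directions m1]in_set [j \in directions m2]in_set.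
rewrite (flat12 _ (connect0 _ _)).
congr (_ && _).
apply: eq_forallb => i; case: (boolP (connect e j i)) => [/flat12->|_] //=.
by rewrite !implybT.
Qed.

Lemma directions_uniq m i j :
  i \in directions m -> j \in directions m -> connect e i j -> i = j.
Proof.
move=> /directionsP[fi mini] /directionsP[fj minj] cij; apply/val_inj/eqP; rewrite eqn_leq.
by rewrite mini // minj // (sym_connect_sym e_graph.1).
Qed.

(** If w is optimal at m and vanishes at j, it costs as much at m + U_(j); a cover
    optimal there costs no more at m, hence is optimal at m too. *)
Lemma flatDU m i j : j \in flat m -> connect e j i -> i \in flat (m + U_(j)) ->
  i \in flat m.
Proof.
move=> /flatP[w /optimalP[cw opt_w] wj] cji /flatP[w' /optimalP[cw' opt_w'] w'i].
apply/flatP; exists w' => //; apply/optimalP; split=> // v cv.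
rewrite -!(weight_same _ _ cji); apply: leq_trans (opt_w v cv).
have := opt_w' w cw; rewrite -!(weight_same _ _ cji) !weightD !weightU connect0 wj /=.
by lia.
Qed.

Lemma directionsDU m j : j \in directions m -> j \in directions (m + U_(j)).
Proof.
move=> /directionsP[fj minj]; apply/directionsP; split=> [|i fi cji]; last first.
  by apply: minj => //; apply: flatDU fi.
have /flatP[w /optimalP[cw opt_w] wj] := fj.
apply/flatP; exists w => //; apply/optimalP; split=> // v cv.
by have := opt_w v cv; rewrite !weightD !weightU connect0 wj /=; lia.
Qed.

(** Replace a given cover by the optimal one on the component of j: the result is
    still a cover, since no edge leaves the component; it costs no more at m and
    does not see the extra unit at j. *)
Lemma nu2_ge_flat t m j : j \in flat m -> nu2_ge e t (m + U_(j)) -> nu2_ge e t m.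
Proof.
move=> /flatP[w /optimalP[cw opt_w] wj] /nu2_geP mt; apply/nu2_geP => v cv.
pose u : {ffun 'I_n -> 'I_3} := [ffun i => if connect e j i then w i else v i].
have cu : two_cover e u.
  apply/two_coverP => a b eab; rewrite !ffunE.
  rewrite -[connect e j b](same_connect_r (sym_connect_sym e_graph.1) (connect1 eab)).
  by case: ifP => _; [apply: two_coverP eab | apply: two_coverP eab].
apply: leq_trans (mt u cu) _.
rewrite weightD weightU /= ffunE connect0 wj addn0.
rewrite /weight (bigID (connect e j)) [leqRHS](bigID (connect e j)) /=.
have -> : \sum_(i < n | connect e j i) u i * m i = weight (connect e j) w m.
  by apply: eq_bigr => i cji; rewrite ffunE cji.
have -> : \sum_(i < n | ~~ connect e j i) u i * m i
    = \sum_(i < n | ~~ connect e j i) v i * m i.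
  by apply: eq_bigr => i /negPf cji; rewrite ffunE cji.
by rewrite leq_add2r opt_w.
Qed.

Lemma directions_addU m i : i \in directions m -> directions (m + U_(i)) = directions m.
Proof.
move=> im; apply/setP => l; case: (boolP (connect e i l)) => [cil|ncil].
  apply/idP/idP => lm; first by rewrite -(directions_uniq (directionsDU im) lm cil).
  by rewrite -(directions_uniq im lm cil) directionsDU.
apply: directions_local => a cla; rewrite mnmDE mnm1E.
case: eqP => [ia|_]; last by rewrite addn0.
by rewrite ia (sym_connect_sym e_graph.1) cla in ncil.
Qed.

Lemma directions_add m (z : 'X_{1..n}) :
  (forall i, 0 < z i -> i \in directions m) -> directions (m + z) = directions m.
Proof.
move: z; apply: mnm_supported_ind => [|z i im IH]; first by rewrite addm0.
by rewrite addmA directions_addU IH.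
Qed.

Lemma nu2_ge_directions t m (z : 'X_{1..n}) : (forall i, 0 < z i -> i \in directions m) ->
  nu2_ge e t (m + z) = nu2_ge e t m.
Proof.
move=> zm; apply/idP/idP; last by apply: nu2_ge_le => i; rewrite mnmDE leq_addr.
suff [] : directions (m + z) = directions m /\ (nu2_ge e t (m + z) -> nu2_ge e t m) by [].
move: z zm; apply: mnm_supported_ind => [|z i im [dz mt]].
  by rewrite addm0.
rewrite -dz in im; rewrite addmA directions_addU //; split=> // mzt; apply: mt.
by case/directionsP: im => im _; apply: nu2_ge_flat mzt.
Qed.

(** An optimal cover with no zero on the component costs at least the total capacity
    of the component, which is at least twice the capacity of the lighter side. *)
Lemma bipartite_flat j : bipartite e [set i | connect e j i] ->
  forall m, exists2 i, connect e j i & i \in flat m.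
Proof.
move=> /existsP[A /forall_inP bipA] m.
have sideP i l : connect e j i -> e i l -> (i \in A) != (l \in A).
  move=> cji eil; have := forall_inP (bipA i _); rewrite inE => /(_ cji l).
  by rewrite inE (connect_trans cji (connect1 eil)) => /(_ isT)/implyP; apply.
have cov2 : two_cover e [ffun=> inord 2].
  by apply/two_coverP => a b _; rewrite !ffunE inordK.
case: (@arg_minnP _ _ (two_cover e) (fun w => weight (connect e j) w m) cov2).
move=> w cw min_w.
have [i /andP[cji /eqP wi]|pos_w] := pickP (fun i => connect e j i && (w i == ord0)).
  exists i => //; apply/flatP; exists w => //; apply/optimalP; split=> // v cv.
  by rewrite -!(weight_same _ _ cji) min_w.
have light v : two_cover e v -> \sum_(i | connect e j i) m i <= weight (connect e j) v m.
  move=> cv; apply: leq_trans (min_w v cv); apply: leq_sum => i cji.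
  by have := pos_w i; rewrite cji -val_eqE /=; case: (nat_of_ord (w i)) => // a _; lia.
pose mA (B : {set 'I_n}) := \sum_(i | connect e j i && (i \in B)) m i.
have mAC B : \sum_(i | connect e j i) m i = mA B + mA (~: B).
  rewrite (bigID (mem B)) /mA; congr (_ + _).
  by apply: eq_bigl => i; rewrite in_setC.
have side (B : {set 'I_n}) i :
    (forall a b, connect e j a -> e a b -> (a \in B) || (b \in B)) ->
    connect e j i -> i \notin B -> mA B <= mA (~: B) -> i \in flat m.
  move=> covB cji iB leB.
  pose u : {ffun 'I_n -> 'I_3} :=
    [ffun a => if connect e j a && (a \notin B) then ord0 else inord 2].
  have uE a : u a = 2 * ~~ (connect e j a && (a \notin B)) :> nat.
    by rewrite ffunE; case: ifP => _; rewrite ?inordK.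
  apply/flatP; exists u; last by rewrite ffunE cji iB.
  apply/optimalP; split=> [|v cv].
    apply/two_coverP => a b eab; rewrite !uE.
    have cab := same_connect_r (sym_connect_sym e_graph.1) (connect1 eab) j.
    case: (boolP (connect e j a)) => [cja|_] /=; last by lia.
    by have := covB a b cja eab; rewrite -cab cja; case: (a \in B); case: (b \in B).
  rewrite -!(weight_same _ _ cji); apply: leq_trans (light v cv).
  apply: leq_trans (_ : mA B + mA B <= _); last by rewrite (mAC B) leq_add2l.
  rewrite /mA -big_split big_mkcondr /= leq_sum // => a cja.
  by rewrite uE cja; case: (a \in B) => /=; lia.
have coverA a b : connect e j a -> e a b -> (a \in A) || (b \in A).
  by move=> cja /(sideP _ _ cja); case: (a \in A); case: (b \in A).
have coverC a b : connect e j a -> e a b -> (a \in ~: A) || (b \in ~: A).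
  by move=> cja /(sideP _ _ cja); rewrite !in_setC; case: (a \in A); case: (b \in A).
have emptyA (B : {set 'I_n}) : (forall i, connect e j i -> i \notin B) -> mA B = 0.
  by move=> noB; rewrite /mA big1 // => i /andP[/noB/negPf->].
(* The side B carrying the weight 2 must leave a vertex of weight 0: take the
   lighter side if both are nonempty, and otherwise the empty one. *)
have [a /andP[cja aA]|noA] := pickP (fun a => connect e j a && (a \in A)); last first.
  have nA i : connect e j i -> i \notin A by move=> cji; have := noA i; rewrite cji /= => ->.
  exists j; rewrite ?connect0 //; apply: (side A) => //; first exact: nA.
  by rewrite (emptyA A).
have [b /andP[cjb bA]|noC] := pickP (fun b => connect e j b && (b \notin A)); last first.
  have nC i : connect e j i -> i \notin ~: A.
    by move=> cji; rewrite in_setC negbK; have := noC i; rewrite cji /= => /negbFE.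
  exists j; rewrite ?connect0 //; apply: (side (~: A)) => //; first exact: nC.
  by rewrite (emptyA (~: A)).
case: (leqP (mA A) (mA (~: A))) => [le|/ltnW le]; first by exists b => //; apply: side le.
by exists a => //; apply: (side (~: A)); rewrite ?setCK // in_setC negbK.
Qed.

Lemma num_bipartite_components_directions m : num_bipartite_components e <= #|directions m|.
Proof.
pose comp i := [set l | connect e i l].
suff sub : [set C in components e | bipartite e C] \subset comp @: directions m.
  exact: leq_trans (subset_leq_card sub) (leq_imset_card _ _).
apply/subsetP => C; rewrite inE => /andP[/imsetP[j _ ->]].
have -> : [set y in setT | connect e j y] = comp j.
  by apply/setP => l; rewrite !inE.
move=> /bipartite_flat/(_ m)[i0 cji0 fi0].
case: (@arg_minnP _ i0 (fun i => (i \in flat m) && connect e j i) val).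
  by rewrite fi0.
move=> i /andP[fi cji] min_i; apply/imsetP; exists i.
  apply/directionsP; split=> // l fl cil; apply: min_i.
  by rewrite fl (connect_trans cji).
by apply/setP => l; rewrite !inE (connect_same cji).
Qed.

End FreeDirections.

(** * Cutting a layer of exponent vectors into orthants *)

Section Orthants.
Variable n : nat.
Implicit Types (s m : 'X_{1..n}) (Z : {set 'I_n}).

Definition in_orthant s Z m : bool :=
  [forall i, if i \in Z then s i <= m i else m i == s i].

Lemma in_orthantP s Z m :
  reflect (exists2 z : 'X_{1..n}, forall i, 0 < z i -> i \in Z & m = (s + z)%MM)
          (in_orthant s Z m).
Proof.
apply: (iffP forallP) => [H|[z zZ ->] i]; last first.
  rewrite mnmDE; case: ifP => iZ; first by rewrite leq_addr.
  by have := zZ i; rewrite iZ; case: (z i) => [|a /(_ isT)//]; rewrite addn0.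
exists (m - s)%MM => [i|].
  by rewrite mnmBE; have := H i; case: ifP => // _ /eqP->; rewrite subnn.
rewrite addmC submK //; apply/mnm_lepP => i.
by have := H i; case: ifP => // _ /eqP->.
Qed.

Definition orthant_partition (P : pred 'X_{1..n}) (d : nat)
    (s : 'I_d -> 'X_{1..n}) (Z : 'I_d -> {set 'I_n}) : Prop :=
  [/\ forall i m, in_orthant (s i) (Z i) m -> P m,
      forall m, P m -> exists i, in_orthant (s i) (Z i) m
    & forall i j m, in_orthant (s i) (Z i) m -> in_orthant (s j) (Z j) m -> i = j].

End Orthants.

Section OrthantPartition.
Variables (n : nat) (e : rel 'I_n).
Hypothesis e_graph : simple_graph e.
Implicit Types (s m : 'X_{1..n}).
Local Notation directions := (directions e).

(** These are the origins of the maximal orthants on which the directions are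
    constant. *)
Definition corner s : bool :=
  [forall j in directions s, (0 < s j) ==> (j \notin directions (s - U_(j)))].

Lemma corner_exists m : exists2 s, corner s & in_orthant s (directions s) m.
Proof.
elim: {m}_.+1 {-2}m (ltnSn (mdeg m)) => // d IHd m le_md.
case: (boolP (corner m)) => [mc|].
  exists m => //; apply/in_orthantP; exists 0%MM; last by rewrite addm0.
  by move=> i; rewrite mnm0E.
rewrite negb_forall_in => /exists_inP[j jm].
rewrite negb_imply negbK => /andP[mj jm'].
have def_m : m = (m - U_(j) + U_(j))%MM by rewrite submK // lep1mP -lt0n.
have [|s sc /in_orthantP[z zs def_m']] := IHd (m - U_(j))%MM.
  by move: le_md; rewrite {1}def_m mdegD mdeg1 addn1.
exists s => //; apply/in_orthantP; exists (z + U_(j))%MM; last first.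
  by rewrite addmA -def_m'.
have dms : directions (m - U_(j)) = directions s by rewrite def_m' directions_add.
move=> i; rewrite mnmDE mnm1E; case: (eqVneq j i) => [<- _|_].
  by rewrite -dms.
by rewrite addn0; apply: zs.
Qed.

Lemma in_orthant_directions s m : in_orthant s (directions s) m -> directions m = directions s.
Proof. by case/in_orthantP => z zs ->; rewrite directions_add. Qed.

(** If s1 were below s2 at a direction j, then s2 - U_(j) would agree on the component
    of j with a vector of the orthant of s1, and so would still have direction j. *)
Lemma corner_le s1 s2 m : corner s2 ->
  in_orthant s1 (directions s1) m -> in_orthant s2 (directions s2) m -> forall j, s2 j <= s1 j.
Proof.
move=> c2 o1 o2 j; have d12 : directions s1 = directions s2.
  by rewrite -(in_orthant_directions o1) (in_orthant_directions o2).
have agree i : i \notin directions s2 -> s1 i = s2 i.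
  move=> /negPf id; have := forallP o1 i; have := forallP o2 i.
  by rewrite d12 id => /eqP-> /eqP.
have [jd|/agree->//] := boolP (j \in directions s2).
rewrite leqNgt; apply/negP => lt12.
have := forall_inP c2 j jd; rewrite (leq_trans _ lt12) //= => /negP; apply.
pose c := (s1 + (U_(j) *+ (s2 j - (s1 j).+1)))%MM.
have -> : (j \in directions (s2 - U_(j))) = (j \in directions c).
  apply: directions_local => i cji; rewrite mnmBE mnmDE mulmnE mnm1E.
  case: (eqVneq j i) => [<-|ji]; first by rewrite mul1n; lia.
  rewrite mul0n addn0 subn0 agree //.
  by apply: contra ji => id; apply/eqP/(directions_uniq e_graph jd).
rewrite /c directions_add //; first by rewrite d12.
by move=> i; rewrite mulmnE mnm1E; case: eqVneq => [<-|_] //; rewrite d12.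
Qed.

Lemma corner_uniq s1 s2 m : corner s1 -> corner s2 ->
  in_orthant s1 (directions s1) m -> in_orthant s2 (directions s2) m -> s1 = s2.
Proof.
move=> c1 c2 o1 o2; apply/mnmP => j; apply/eqP; rewrite eqn_leq.
by rewrite (corner_le c1 o2 o1) (corner_le c2 o1 o2).
Qed.

(** Besides its directions, a corner in the box [0, N]^n is free to grow at the
    coordinates that have reached N, where truncation forgets the excess. *)
Definition zone N s : {set 'I_n} := directions s :|: [set i | N <= s i].

Lemma in_orthant_zone N s m : (forall i, s i <= N) ->
  in_orthant s (zone N s) m = in_orthant s (directions s) (trunc N m).
Proof.
move=> leN; apply: eq_forallb => i; have := leN i.
rewrite in_setU [X in _ || X]in_set truncE.
case: (i \in directions s) => /= le; first by rewrite leq_min le andbT.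
by case: ifP => ltN; apply/idP/idP; lia.
Qed.

Lemma orthant_partition_layer (k : nat) :
  exists d (s : 'I_d -> 'X_{1..n}) (Z : 'I_d -> {set 'I_n}),
    orthant_partition (fun m => nu2_ge e (2 * k) m && ~~ nu2_ge e (2 * k.+1) m) s Z
    /\ forall i, num_bipartite_components e <= #|Z i|.
Proof.
set P := fun m => _; pose N := 2 * k.+1.
have truncP m : P (trunc N m) = P m.
  by rewrite /P !nu2_ge_trunc // leq_mul.
have dir_inv s m : in_orthant s (directions s) m -> P m = P s.
  by case/in_orthantP => z zs ->; rewrite /P !nu2_ge_directions.
pose mon (u : {ffun 'I_n -> 'I_N.+1}) := [multinom (u i : nat) | i < n].
have monN u i : mon u i <= N by rewrite mnmE -ltnS.
have mon_inj : injective mon.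
  move=> u v /mnmP uv; apply/ffunP => i; apply/val_inj.
  by have := uv i; rewrite !mnmE.
have mon_onto s : (forall i, s i <= N) -> exists u, s = mon u.
  move=> sN; exists [ffun i => inord (s i)]; apply/mnmP => i.
  by rewrite mnmE ffunE inordK // ltnS.
pose B := [set u | corner (mon u) && P (mon u)].
exists #|B|, (fun i => mon (enum_val i)), (fun i => zone N (mon (enum_val i))).
split; last first.
  move=> i; apply: leq_trans (num_bipartite_components_directions e_graph _) _.
  exact: subset_leq_card (subsetUl _ _).
have BP (i : 'I_#|B|) : corner (mon (enum_val i)) && P (mon (enum_val i)).
  by have := enum_valP i; rewrite inE.
split=> [i m|m Pm|i j m].
- rewrite in_orthant_zone // => /dir_inv; rewrite truncP => ->.
  by case/andP: (BP i).
- have [s sc sm] := corner_exists (trunc N m).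
  have [u su] : exists u, s = mon u.
    apply: mon_onto => i; case/in_orthantP: sm => z _ /mnmP/(_ i).
    by rewrite truncE mnmDE; lia.
  have uB : u \in B by rewrite inE -su sc -(dir_inv _ _ sm) truncP.
  by exists (enum_rank_in uB u); rewrite enum_rankK_in // -su in_orthant_zone // su.
- rewrite !in_orthant_zone // => oi oj; apply/enum_val_inj/mon_inj.
  by case/andP: (BP i) => ci _; case/andP: (BP j) => cj _; apply: corner_uniq oi oj.
Qed.

End OrthantPartition.

Local Open Scope ring_scope.

(** * Powers of ideals and the determinant trick *)

Section IdealPowers.
Variable R : comNzRingType.
Implicit Types (I J G : R -> Prop) (a b : R).

Record is_ideal I : Prop := IsIdeal {
  ideal0 : I 0;
  idealD : forall a b, I a -> I b -> I (a + b);
  idealM : forall a b, I b -> I (a * b) }.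

Lemma ideal_sum I (T : Type) (r : seq T) (P : pred T) (F : T -> R) :
  is_ideal I -> (forall i, P i -> I (F i)) -> I (\sum_(i <- r | P i) F i).
Proof. by move=> idI FI; apply: (big_ind I) FI; [apply: ideal0|apply: idealD]. Qed.

Lemma ideal_gen_ideal G : is_ideal (ideal_gen G).
Proof.
split=> [|a b [s Gs ->] [t Gt ->]|a b [s Gs ->]].
- by exists [::]; rewrite ?big_nil.
- exists (s ++ t); last by rewrite big_cat.
  by move=> q; rewrite mem_cat => /orP[/Gs|/Gt].
- exists [seq (a * q.1, q.2) | q <- s]; first by move=> q /mapP[q' /Gs ? ->].
  by rewrite big_map big_distrr; apply: eq_bigr => q _; rewrite /= mulrA.
Qed.

Lemma mem_ideal_gen G a : G a -> ideal_gen G a.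
Proof.
move=> Ga; exists [:: (1, a)]; last by rewrite big_seq1 mul1r.
by move=> q; rewrite inE => /eqP->.
Qed.

Lemma ideal_exp_ideal I k : is_ideal (ideal_exp I k).
Proof. by case: k => [|k]; [split | apply: ideal_gen_ideal]. Qed.

Lemma ideal_expM I k a b : I a -> ideal_exp I k b -> ideal_exp I k.+1 (a * b).
Proof. by move=> Ia Ib; apply: mem_ideal_gen; exists a, b. Qed.

(** Give X and the elements of J degree 1: every entry of M is then homogeneous of
    degree 1 and the determinant of degree s. *)
Lemma det_coef_ideal_exp J (s : nat) (M : 'M[{poly R}]_s) :
    is_ideal J ->
    (forall i j, exists a b, J b /\ M i j = a%:P * 'X + b%:P) ->
  forall l, ideal_exp J (s - l) (\det M)`_l.
Proof.
move=> idJ MJ l; rewrite /determinant coef_sum.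
apply: ideal_sum => [|u _]; first exact: ideal_exp_ideal.
have -> : (-1) ^+ u = ((-1) ^+ u)%:P :> {poly R} by rewrite rmorphXn /= rmorphN1.
rewrite coefCM; apply: idealM; first exact: ideal_exp_ideal.
suff prodJ (r : seq 'I_s) l' :
    ideal_exp J (size r - l') (\prod_(i <- r) M i (u i))`_l'.
  by have := prodJ (enum 'I_s) l; rewrite size_enum_ord big_enum.
elim: r l' => [|i r IHr] l'; first by rewrite sub0n.
have [a [b [Jb Mab]]] := MJ i (u i).
rewrite big_cons Mab mulrDl -mulrA coefD !coefCM coefXM.
apply: idealD; first exact: ideal_exp_ideal.
  apply: idealM; first exact: ideal_exp_ideal.
  by case: l' => [|l'] /=; [exact: ideal0 (ideal_exp_ideal J (size r).+1) | rewrite subSS].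
have [lt|le] := leqP (size r).+1 l'; first by rewrite (eqP lt).
by rewrite /= subSn //; apply: ideal_expM.
Qed.

End IdealPowers.

Definition in_span (R : nzRingType) (J : R -> Prop) (s : nat) (h : 'I_s -> R) (f : R) :=
  exists2 a : 'I_s -> R, forall j, J (a j) & f = \sum_j a j * h j.

(** The determinant trick: f is a root of the characteristic polynomial of the
    matrix expressing multiplication by f on the h i, as the vector h is nonzero. *)
Lemma integral_closure_stable (R : idomainType) (J : R -> Prop) (f : R)
    (s : nat) (h : 'I_s -> R) (i0 : 'I_s) :
  is_ideal J -> h i0 != 0 ->
  (forall i, in_span J h (f * h i)) ->
  integral_closure J f.
Proof.
move=> idJ h0 hJ.
have [a aJ ha] : exists2 a : 'I_s -> 'I_s -> R, forall i j, J (a i j)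
    & forall i, f * h i = \sum_j a i j * h j.
  have /fin_all_exists2[a aJ ha] := hJ; by exists a.
pose A : 'M[R]_s := \matrix_(i, j) a i j.
have detJ := @det_coef_ideal_exp _ J s (char_poly_mx A) idJ.
have s_gt0 : (0 < s)%N by case: s i0 {h h0 hJ a aJ ha A detJ} => [[]|].
exists s, (fun i => (char_poly A)`_(s - i)); split=> // [i /andP[_ le_is]|].
  rewrite -{1}(subKn le_is); apply: detJ => {le_is i} i j.
  exists ((i == j)%:R), (- a i j); split.
    by rewrite -mulN1r; apply: idealM.
  rewrite !mxE polyCN; congr (_ - _).
  by case: (i == j); rewrite ?mulr1n ?mulr0n ?mul1r ?polyC0 ?mul0r.
suff fA : (char_poly A).[f] = 0.
  rewrite -[RHS]fA horner_coef size_char_poly big_ord_recr /=.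
  have := char_poly_monic A; rewrite monicE lead_coefE size_char_poly /= => /eqP->.
  rewrite mul1r addrC; congr (_ + _).
  rewrite big_add1 /= big_mkord (reindex_inj rev_ord_inj) /=.
  by apply: eq_bigr => i _; rewrite -subSn // subSS subKn // ltnW.
pose B := map_mx (horner_eval f) (char_poly_mx A).
have Bh : B *m (\col_i h i) = 0.
  apply/matrixP => i j; rewrite !mxE -[RHS](subrr (f * h i)) {2}ha.
  rewrite (eq_bigr (fun k => f *+ (i == k) * h k - a i k * h k)) => [|k _].
    rewrite big_split /= sumrN; congr (_ - _).
    rewrite (bigD1 i) //= eqxx big1 ?addr0 // => k /negPf ki.
    by rewrite eq_sym ki mul0r.
  rewrite !mxE /horner_eval -mulrBl hornerD hornerN hornerC hornerMn hornerX.
  by [].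
have : (\det B)%:M *m (\col_i h i) = 0 by rewrite -mul_adj_mx -mulmxA Bh mulmx0.
move/matrixP/(_ i0 0); rewrite mul_scalar_mx !mxE => /eqP.
by rewrite mulf_eq0 (negPf h0) orbF det_map_mx => /eqP.
Qed.

Lemma span_ideal (R : comNzRingType) (J : R -> Prop) (s : nat) (h : 'I_s -> R) :
  is_ideal J -> is_ideal (in_span J h).
Proof.
move=> idJ; split=> [|_ _ [a aJ ->] [b bJ ->]|c _ [b bJ ->]].
- exists (fun=> 0) => [j|]; first exact: ideal0 idJ.
  by rewrite big1 // => j _; rewrite mul0r.
- exists (fun j => a j + b j) => [j|]; first exact: idealD.
  by rewrite -big_split; apply: eq_bigr => j _; rewrite mulrDl.
- exists (fun j => c * b j) => [j|]; first exact: idealM.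
  by rewrite big_distrr; apply: eq_bigr => j _; rewrite /= mulrA.
Qed.

Lemma integral_closure_full (R : comNzRingType) (f : R) :
  integral_closure (fun=> True) f.
Proof.
exists 1%N, (fun=> - f); split=> // [[|[|i]] // _|].
  by rewrite -[- f]mulr1; apply: ideal_expM.
by rewrite big_nat1 subnn expr0 expr1 mulr1 subrr.
Qed.

Lemma integral_closure0 (R : comNzRingType) (J : R -> Prop) : integral_closure J 0.
Proof.
exists 1%N, (fun=> 0); split=> // [i _|]; first exact: ideal0 (ideal_exp_ideal J i).
by rewrite big_nat1 mul0r expr1 addr0.
Qed.

Lemma rmorph_ideal_gen (R S : comNzRingType) (phi : {rmorphism R -> S})
    (G : R -> Prop) (x : S) :
  (forall a, G a -> exists g, phi a = g * x) ->
  forall a, ideal_gen G a -> exists g, phi a = g * x.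
Proof.
move=> phiG a [s sG ->]; rewrite rmorph_sum /=; elim: s sG => [|q s IHs] sG.
  by exists 0; rewrite big_nil mul0r.
have [|g gE] := IHs; first by move=> p ps; apply: sG; rewrite inE ps orbT.
have [g1 g1E] := phiG _ (sG q (mem_head _ _)).
by exists (phi q.1 * g1 + g); rewrite big_cons gE mulrDl rmorphM g1E mulrA.
Qed.

Lemma rmorph_ideal_exp (R S : comNzRingType) (phi : {rmorphism R -> S})
    (I : R -> Prop) (x : S) (c : nat) :
  (forall a, I a -> exists g, phi a = g * x ^+ c) ->
  forall k a, ideal_exp I k a -> exists g, phi a = g * x ^+ (c * k).
Proof.
move=> phiI; elim=> [|k IHk] a /=; first by exists (phi a); rewrite muln0 mulr1.
apply: rmorph_ideal_gen => _ [a1 [a2 [/phiI[g1 g1E] /IHk[g2 g2E] ->]]].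
by exists (g1 * g2); rewrite rmorphM g1E g2E mulrACA -exprD mulnS.
Qed.

(** If F has order d < c at 0, every term of the equation but F^r has order greater
    than d r, so F must have order greater than d. *)
Lemma dvdXn_integral (A : idomainType) (F : {poly A}) (c r : nat)
    (b : nat -> {poly A}) :
  (0 < r)%N ->
  (forall i, (1 <= i <= r)%N -> exists g, b i = g * 'X^(c * i)) ->
  F ^+ r + \sum_(1 <= i < r.+1) b i * F ^+ (r - i) = 0 ->
  exists G, F = G * 'X^c.
Proof.
move=> r_gt0 bX eqF.
suff: forall d, (d <= c)%N -> exists G, F = G * 'X^d by apply.
elim=> [|d IHd] ltdc; first by exists F; rewrite mulr1.
have [G FG] := IHd (ltnW ltdc).
suff /factor_theorem[G' GX] : root G 0.
  by exists G'; rewrite FG GX subr0 -mulrA -exprS.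
suff : exists H, G ^+ r * 'X^(d * r) = H * 'X * 'X^(d * r).
  case=> H /(mulIf _); rewrite expf_neq0 ?polyX_eq0 // => /(_ isT) GH.
  have : G.[0] ^+ r == 0 by rewrite -horner_exp GH hornerMX mulr0.
  by rewrite expf_eq0 r_gt0.
have -> : G ^+ r * 'X^(d * r) = F ^+ r by rewrite FG exprMn exprM.
rewrite -[F ^+ r](addrK (\sum_(1 <= i < r.+1) b i * F ^+ (r - i))) eqF sub0r.
suff [H ->] : exists H, \sum_(1 <= i < r.+1) b i * F ^+ (r - i) = H * 'X * 'X^(d * r).
  by exists (- H); rewrite !mulNr.
rewrite big_nat; elim/big_rec: _ => [|i _ /andP[i_gt0 le_ir] [H ->]].
  by exists 0; rewrite !mul0r.
have [g ->] := bX i (introT andP (conj i_gt0 le_ir)).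
have [q def_q] : exists q, (c * i + d * (r - i) = (d * r).+1 + q)%N.
  by exists (c * i + d * (r - i) - (d * r).+1)%N; nia.
exists (g * G ^+ (r - i) * 'X^q + H).
rewrite 2!mulrDl; congr (_ + _); rewrite FG exprMn -exprM.
by rewrite mulrACA -exprD def_q exprD exprS; ring.
Qed.

(** * The integral closure of a power of an edge ideal *)

Section ClosureOfEdgeIdealPowers.
Variables (K : fieldType) (n : nat) (e : rel 'I_n).
Hypothesis e_graph : simple_graph e.
Local Notation I := (edge_ideal e K).
Implicit Types (f : {mpoly K[n]}) (m : 'X_{1..n}).

Lemma nu2_ge_factor k t m : nu2_ge e (t + 2 * k) m -> (n ^ 2 <= t)%N ->
  exists m1 m2, [/\ m = (m1 + m2)%MM, ideal_exp I k 'X_[m1] & nu2_ge e t m2].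
Proof.
move=> + le_t; elim: k m => [|k IHk] m.
  by rewrite addn0 => mt; exists 0%MM, m; split; rewrite ?add0m.
rewrite mulnS addnCA => /(nu2_ge_edge e_graph)[|i [j [eij ij_m]]].
  by rewrite (leq_trans le_t) ?leq_addr.
move=> /IHk[m1 [m2 [def_m m1I m2t]]].
exists (U_(i) + U_(j) + m1)%MM, m2; split=> //.
  by rewrite -addmA -def_m addmC submK.
by rewrite !mpolyXD; apply: ideal_expM => //; apply: mem_ideal_gen; exists i, j.
Qed.

(** The ideal generated by the monomials x^h in the box [0, n^2]^n with
    nu2(h) >= n^2 is carried by f into its product with I^k: factor k edges out of
    x^(m + h) and truncate what is left to the box. *)
Lemma nu2_ge_integral k f :
  (forall m, m \in msupp f -> nu2_ge e (2 * k) m) -> integral_closure (ideal_exp I k) f.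
Proof.
case: k => [_|k ft]; first exact: integral_closure_full.
have [->|nz_f] := eqVneq f 0; first exact: integral_closure0.
pose t := (n ^ 2)%N; pose box : finType := {ffun 'I_n -> 'I_t.+1}.
pose mon (u : box) := [multinom (u i : nat) | i < n].
(* The value 0 discards the box points outside the ideal, so that the whole box
   can index the generators. *)
pose h (u : box) : {mpoly K[n]} := if nu2_ge e t (mon u) then 'X_[mon u] else 0.
have monE m : exists u, trunc t m = mon u.
  exists [ffun i => inord (minn (m i) t)]; apply/mnmP => i.
  by rewrite truncE mnmE ffunE inordK // ltnS geq_minr.
have [u0 u0E] := monE (mlead f *+ t)%MM.
have nz_h0 : h u0 != 0.
  rewrite /h -u0E nu2_ge_trunc // (nu2_geW _ (nu2_geMn t (ft _ (mlead_supp nz_f)))).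
    by rewrite -msupp_eq0 msuppX.
  by rewrite leq_pmull.
have idI : is_ideal (ideal_exp I k.+1) by apply: ideal_exp_ideal.
pose hv (j : 'I_#|box|) := h (enum_val j).
apply: (@integral_closure_stable _ _ _ _ hv (enum_rank u0) idI).
  by rewrite /hv enum_rankK.
move=> i; have idS := span_ideal hv idI.
rewrite [hv _]/hv /h; case: ifP => [ut|_]; last by rewrite mulr0; apply: ideal0 idS.
rewrite (mpolyE f) big_distrl big_seq; apply: ideal_sum => // m mf.
have := nu2_geD (ft _ mf) ut; rewrite addnC => /nu2_ge_factor/(_ (leqnn _)).
case=> m1 [m2 [def_m m1I m2t]]; have [v vE] := monE m2.
have def_m2 : m2 = (m2 - trunc t m2 + mon v)%MM.
  by rewrite -vE submK //; apply/mnm_lepP => j; rewrite truncE geq_minl.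
rewrite /= -scalerAl -mpolyXD def_m {1}def_m2 addmA 2!mpolyXD scalerAl.
pose c := f@_m *: ('X_[m1] * 'X_[m2 - trunc t m2]) : {mpoly K[n]}.
exists (fun j => if j == enum_rank v then c else 0) => [j|].
  case: ifP => _; last exact: ideal0 idI.
  by rewrite /c mulrC scalerAl; apply: idealM.
rewrite (bigD1 (enum_rank v)) //= eqxx big1 ?addr0 => [|j /negPf->].
  by rewrite /hv enum_rankK /h -vE nu2_ge_trunc // m2t.
by rewrite mul0r.
Qed.

Section WeightGrading.
Variable w : {ffun 'I_n -> 'I_3}.

(** The substitution x_i -> x_i X^(w i), which records the weight w.m of x^m as an
    exponent of X. *)
Definition weight_map : {mpoly K[n]} -> {poly {mpoly K[n]}} :=
  mmap (polyC \o @mpolyC n K) (fun i => ('X_i)%:P * 'X^(w i)).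

HB.instance Definition _ := GRing.Additive.copy weight_map
  (mmap (polyC \o @mpolyC n K) (fun i => ('X_i)%:P * 'X^(w i))).
HB.instance Definition _ := GRing.RMorphism.copy weight_map
  (mmap (polyC \o @mpolyC n K) (fun i => ('X_i)%:P * 'X^(w i))).

Lemma weight_mapX m : weight_map 'X_[m] = ('X_[m])%:P * 'X^(weight predT w m).
Proof.
rewrite /weight_map mmapX /mmap1 mpolyXE_id rmorph_prod /=.
under eq_bigr => i _ do rewrite exprMn -exprM.
by rewrite big_split /= prodrXr; congr (_ * _); apply: eq_bigr => i _; rewrite rmorphXn.
Qed.

Lemma coef_weight_map f d m :
  (weight_map f)`_d@_m = f@_m * (weight predT w m == d)%:R.
Proof.
rewrite {2}(mpolyE f) !raddf_sum mulr_suml /weight_map /mmap coef_sum raddf_sum /=.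
apply: eq_bigr => m' _; have := weight_mapX m'.
rewrite /weight_map mmapX => ->; rewrite mulrA -polyCM mul_mpolyC coefCM coefXn.
rewrite mulr_natr mcoeffMn mcoeffZ mcoeffX [RHS]mulr_natr (eq_sym d).
by case: (eqVneq m' m) => [->|_] //; rewrite mulr0 !mul0rn.
Qed.

(** Edge monomials have weight at least 2 for w, so I^k has order at least 2k, and
    orders survive integral dependence. *)
Lemma edge_ideal_closure_weight k f m :
  two_cover e w -> integral_closure (ideal_exp I k) f -> m \in msupp f ->
  (2 * k <= weight predT w m)%N.
Proof.
move=> cw [r [a [r_gt0 aI fr]]].
have edge_ge2 b : I b -> exists g, weight_map b = g * 'X ^+ 2.
  apply: rmorph_ideal_gen => _ [i [j [eij ->]]].
  have [q def_ij] : exists q, (w i + w j = 2 + q)%N.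
    by exists (w i + w j - 2)%N; rewrite subnKC // (two_coverP _ _ cw).
  exists (('X_[U_(i) + U_(j)])%:P * 'X^q).
  by rewrite -mpolyXD [LHS]weight_mapX weightD !weightU /= def_ij exprD mulrCA mulrC.
have power_ge := rmorph_ideal_exp (rmorph_ideal_exp edge_ge2 (k := k)).
have [b [bE]] : exists b, (forall i, b i = weight_map (a i)) /\
    weight_map f ^+ r + \sum_(1 <= i < r.+1) b i * weight_map f ^+ (r - i) = 0.
  exists (weight_map \o a); split=> //.
  rewrite -[RHS](rmorph0 weight_map) -fr rmorphD rmorph_sum rmorphXn /=; congr (_ + _).
  by apply: eq_bigr => i _; rewrite rmorphM rmorphXn.
case/(dvdXn_integral (c := 2 * k) r_gt0) => [i le_ir|G fG].
  by rewrite bE; apply: power_ge; apply: aI.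
rewrite mcoeff_msupp leqNgt; apply: contraNN => lt.
have := coef_weight_map f (weight predT w m) m.
by rewrite fG coefMXn lt eqxx mulr1 mcoeff0 => <-.
Qed.

End WeightGrading.

Lemma integral_closure_edge_ideal k f :
  integral_closure (ideal_exp I k) f <->
  forall m, m \in msupp f -> nu2_ge e (2 * k) m.
Proof.
split=> [fI m mf|]; last exact: nu2_ge_integral.
by apply/nu2_geP => w cw; apply: edge_ideal_closure_weight mf.
Qed.

End ClosureOfEdgeIdealPowers.

(** * Stanley decompositions from orthants *)

Lemma decidebP (Q : Prop) : reflect Q (decideb Q).
Proof. by rewrite /decideb; case: excluded_middle_informative; constructor. Qed.

Section StanleyOfOrthants.
Variables (K : fieldType) (n : nat).
Variables (J J' : {mpoly K[n]} -> Prop) (A A' : pred 'X_{1..n}).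
Hypothesis JE : forall f, J f <-> forall m, m \in msupp f -> A m.
Hypothesis J'E : forall f, J' f <-> forall m, m \in msupp f -> A' m.
Variables (d : nat) (s : 'I_d -> 'X_{1..n}) (Z : 'I_d -> {set 'I_n}).
Hypothesis part : orthant_partition (fun m => A m && ~~ A' m) s Z.

Lemma msupp_orthant i (g : {mpoly K[n]}) m :
  in_KZ (Z i) g -> m \in msupp ('X_[s i] * g) -> in_orthant (s i) (Z i) m.
Proof.
move=> /allP gZ; rewrite mulrC (perm_mem (msuppMX _ _)) => /mapP[z zg ->].
apply/in_orthantP; exists z; last by rewrite addmC.
by move=> j; rewrite lt0n => zj; have /forallP/(_ j) := gZ z zg; rewrite zj.
Qed.

Lemma orthant_stanley_decomposition :
  stanley_decomposition J J' (StanleyFamily (fun i => 'X_[s i]) Z).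
Proof.
have [sub cov disj] := part.
have zero (f : {mpoly K[n]}) : (forall m, m \notin msupp f) -> f = 0.
  by move=> f0; apply/mpolyP => m; rewrite mcoeff0 memN_msupp_eq0.
have J'0 : J' 0 by apply/J'E => m; rewrite msupp0.
have free i (g : {mpoly K[n]}) :
    in_KZ (Z i) g -> J' ('X_[s i] * g) -> 'X_[s i] * g = 0.
  move=> gZ /J'E gJ; apply: zero => m; apply/negP => mg.
  by have /andP[_ /negP] := sub _ _ (msupp_orthant gZ mg); apply; apply: gJ.
split=> /= [i|f /JE fA|g gZ /J'E sumJ i].
- split.
  + apply/JE => m; rewrite msuppX inE => /eqP->.
    suff /sub/andP[] : in_orthant (s i) (Z i) (s i) by [].
    by apply/in_orthantP; exists 0%MM; rewrite ?addm0 // => j; rewrite mnm0E.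
  + by exists 1, (s i); rewrite scale1r.
  + move=> g gZ /(free i g gZ)/eqP; rewrite mulf_eq0 => /orP[|/eqP//].
    by rewrite -msupp_eq0 msuppX.
- pose g i : {mpoly K[n]} :=
    \sum_(m <- msupp f | in_orthant (s i) (Z i) m) f@_m *: 'X_[m - s i].
  have gE i : 'X_[s i] * g i
      = \sum_(m <- msupp f | in_orthant (s i) (Z i) m) f@_m *: 'X_[m].
    rewrite big_distrr; apply: eq_bigr => m /in_orthantP[z _ ->] /=.
    by rewrite (_ : s i + z - s i = z)%MM ?mpolyXD ?scalerAr // addmC addmK.
  exists g => [i|].
    apply/allP => z /msupp_sum_le /flatten_mapP[m].
    rewrite mem_filter => /andP[/in_orthantP[z' z'Z ->] _].
    move=> /msuppZ_le; rewrite addmC addmK msuppX inE => /eqP->.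
    by apply/forallP => j; apply/implyP; rewrite -lt0n; apply: z'Z.
  apply/J'E => m; rewrite mcoeff_msupp; apply: contraNT => nA'.
  rewrite mcoeffB raddf_sum subr_eq0 /=; apply/eqP.
  have coefg i : ('X_[s i] * g i)@_m = if in_orthant (s i) (Z i) m then f@_m else 0.
    rewrite gE raddf_sum /= big_mkcond /=.
    transitivity ((if in_orthant (s i) (Z i) m then f else 0)@_m); last first.
      by case: ifP; rewrite ?mcoeff0.
    case: ifP => om; last first.
      rewrite mcoeff0 big1 // => m' _; case: ifP => // om'.
      rewrite mcoeffZ mcoeffX; case: eqP => [mm|_]; rewrite ?mulr0 //.
      by rewrite mm om in om'.
    rewrite [RHS](congr1 (mcoeff m) (mpolyE f)) raddf_sum /=.
    apply: eq_bigr => m' _; case: ifP => // om'.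
    rewrite mcoeffZ mcoeffX; case: eqP => [mm|_]; rewrite ?mulr0 //.
    by rewrite mm om in om'.
  have [/fA mA|/memN_msupp_eq0 fm] := boolP (m \in msupp f); last first.
    by rewrite fm big1 // => i _; rewrite coefg fm if_same.
  have [|i0 oi0] := cov m; first by rewrite mA.
  rewrite (bigD1 i0) //= coefg oi0 big1 ?addr0 // => i ne_i.
  by rewrite coefg; case: ifP => // oi; rewrite (disj _ _ _ oi oi0) eqxx in ne_i.
- suff -> : 'X_[s i] * g i = 0 by [].
  apply: zero => m; apply/negP => mi; have om := msupp_orthant (gZ i) mi.
  have /andP[_ /negP] := sub _ _ om; apply; apply: sumJ.
  rewrite mcoeff_msupp raddf_sum (bigD1 i) //= big1 ?addr0 -?mcoeff_msupp // => j ne_j.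
  apply: memN_msupp_eq0; apply: contra ne_j => mj.
  by rewrite (disj _ _ _ (msupp_orthant (gZ j) mj) om).
Qed.

Lemma sdepth_orthants p : (forall i, p <= #|Z i|)%N -> leq_infty (Some p) (sdepth J J').
Proof.
move=> le_p; rewrite /sdepth; case: decidebP => //= JJ'.
have d_gt0 : (0 < d)%N.
  rewrite lt0n; apply/eqP => d0; apply: JJ' => f /JE fA; apply/J'E => m mf.
  apply: contraT => nA'; have [_ cov _] := part.
  by have [|i _] := cov m; [rewrite fA | case: i; rewrite d0].
pose depth := \big[minn/n]_(i < d) #|Z i|.
have le_depth : (depth <= n)%N.
  by rewrite /depth; elim/big_rec: _ => // i x _ xn; rewrite geq_min xn orbT.
have p_depth : (p <= depth)%N.
  rewrite /depth; elim/big_rec: _ => [|i x _ px]; last by rewrite leq_min le_p.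
  by rewrite (leq_trans (le_p (Ordinal d_gt0))) // -[n in leqRHS]card_ord max_card.
pose d0 : 'I_n.+1 := Ordinal (le_depth : (depth < n.+1)%N).
apply: leq_trans (p_depth : (p <= d0)%N) _.
apply: (@leq_bigmax_cond _ _ (fun d : 'I_n.+1 => nat_of_ord d)).
apply/decidebP; exists (StanleyFamily (fun i => 'X_[s i]) Z); split.
  exact: orthant_stanley_decomposition.
by rewrite /sdepth_decomposition /= eqn0Ngt d_gt0.
Qed.

End StanleyOfOrthants.

Theorem theorem3p7 (K : fieldType) (n : nat) (G : rel 'I_n)
    (G_graph : simple_graph G) (k : nat) :
  leq_infty (Some (num_bipartite_components G))
    (sdepth (integral_closure (ideal_exp (edge_ideal G K) k))
            (integral_closure (ideal_exp (edge_ideal G K) k.+1))).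
Proof.
have [d [s [Z [part le_Z]]]] := orthant_partition_layer G_graph k.
apply: sdepth_orthants part _ le_Z => f; exact: integral_closure_edge_ideal.
Qed.
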